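(* For every $n\ge1$, the partition function of the dimer model on the loopless Schreier graph $\Sigma_n$ of the Basilica group, with positive weights $a,b$ on edges labeled $a,b$ respectively, is $$\Phi_n(a,b)=\begin{cases}2^{\frac{2^n+1}{3}}\,b^{2^{n-1}} & n\text{ odd},\\[2pt] 2^{\frac{2^n+2}{3}}\,b^{2^{n-1}} & n\text{ even}.\end{cases}$$
   Context: The Basilica group is generated by the maps $a,b$ on binary words defined recursively for any binary word $w$ by - $a(0w)=0\,b(w)$ and $a(1w)=1w$; - $b(0w)=1\,a(w)$ and $b(1w)=0w$. The loopless Schreier graph $\Sigma_n$ has vertex set $\{0,1\}^n$. For each $s\in\{a,b\}$ and each $u\in\{0,1\}^n$ with $s(u)\ne u$, it has one edge labeled $s$ joining $u$ to $s(u)$. In particular, an orbit $\{u,s(u)\}$ of size $2$ yields two parallel edges labeled $s$. An edge labeled $s$ has weight $s>0$. A dimer covering is a perfect matching of $\Sigma_n$, and its weight is the product of the weights of its edges. $\Phi_n(a,b)$ is the sum of the weights of all dimer coverings. *)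

(* Defs.v *)
From HB Require Import structures.
From mathcomp Require Import all_boot all_order all_algebra.

Set Implicit Arguments.
Unset Strict Implicit.
Unset Printing Implicit Defensive.

Import GRing.Theory.
Local Open Scope ring_scope.

Variant generator := gen_a | gen_b.

Definition bool_of_generator (s : generator) : bool :=
  if s is gen_a then false else true.

Definition generator_of_bool (c : bool) : generator :=
  if c then gen_b else gen_a.

Lemma bool_of_generatorK : cancel bool_of_generator generator_of_bool.
Proof. by case. Qed.

HB.instance Definition _ :=
  Finite.copy generator (can_type bool_of_generatorK).

(* The letters 0 and 1 are encoded as false and true. *)
Fixpoint basilica_a (w : seq bool) : seq bool :=
  match w with
  | [::] => [::]
  | false :: v => false :: basilica_b v
  | true :: v => true :: v
  end
with basilica_b (w : seq bool) : seq bool :=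
  match w with
  | [::] => [::]
  | false :: v => true :: basilica_a v
  | true :: v => false :: v
  end.

Definition basilica (s : generator) : seq bool -> seq bool :=
  match s with gen_a => basilica_a | gen_b => basilica_b end.

Lemma size_basilica s w : size (basilica s w) = size w.
Proof. by elim: w s => [|[] w IHw] [] //=; rewrite ?(IHw gen_a) ?(IHw gen_b). Qed.

Definition word (n : nat) := n.-tuple bool.

Lemma basilica_tupleP n (s : generator) (u : word n) :
  size (basilica s u) == n.
Proof. by rewrite size_basilica size_tuple. Qed.

Definition act n (s : generator) (u : word n) : word n :=
  Tuple (basilica_tupleP s u).

(* The edge labeled s joining u to s(u) is the pair (s, u), so that the edges
   arising from u and from s(u) stay distinct even if they are parallel. *)
Definition schreier_edges n : {set generator * word n} :=
  [set e | act e.1 e.2 != e.2].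

Definition incident n (v : word n) (e : generator * word n) : bool :=
  (v == e.2) || (v == act e.1 e.2).

Definition dimer_covering n (M : {set generator * word n}) : bool :=
  (M \subset schreier_edges n) &&
  [forall v : word n, #|[set e in M | incident v e]| == 1%N].

Definition label_weight (R : pzSemiRingType) (a b : R) (s : generator) : R :=
  match s with gen_a => a | gen_b => b end.

Definition dimer_partition (R : comPzSemiRingType) n (a b : R) : R :=
  \sum_(M : {set generator * word n} | dimer_covering M)
     \prod_(e in M) label_weight a b e.1.

(* Main.v *)
(** A word [1w] is fixed by [a], so a dimer covering must match it along a
    [b]-edge, and every [b]-edge joins a word [1w] to a word [0w'].  As there are
    as many words starting with [0] as with [1], the [b]-edges already cover
    everything and no [a]-edge is used.  Hence coverings correspond to the sets
    [S] of words that [b] exchanges with their complement (take the sources of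
    the edges).  Such an [S] of level [n+1] is [0T] together with [1T^c] for an
    [a]-invariant set [T] of level [n]; splitting words by their first letter,
    the numbers of [a]- and [b]-invariant sets satisfy
    [A(n+1) = B(n) 2^(2^n)] and [B(n+1) = A(n)]. *)
Require Import Defs.
From mathcomp Require Import all_boot all_order all_algebra.
From mathcomp Require Import zify.

Set Implicit Arguments.
Unset Strict Implicit.
Unset Printing Implicit Defensive.

Import Order.TTheory GRing.Theory Num.Theory.
Local Open Scope ring_scope.

(** * The generators as permutations of words *)

Lemma basilica_inj s : injective (basilica s).
Proof.
move=> u v; elim: u s v => [|[] u IHu] [] [|[] v] //= [].
- by move->.
- by move/(IHu gen_b)->.
- by move/(IHu gen_a)->.
Qed.

Lemma act_inj n s : injective (@act n s).
Proof. by move=> u v /(congr1 val) /basilica_inj /val_inj. Qed.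

Lemma act_a0 n (w : word n) :
  act gen_a (cons_tuple false w) = cons_tuple false (act gen_b w).
Proof. exact: val_inj. Qed.

Lemma act_a1 n (w : word n) : act gen_a (cons_tuple true w) = cons_tuple true w.
Proof. exact: val_inj. Qed.

Lemma act_b0 n (w : word n) :
  act gen_b (cons_tuple false w) = cons_tuple true (act gen_a w).
Proof. exact: val_inj. Qed.

Lemma act_b1 n (w : word n) : act gen_b (cons_tuple true w) = cons_tuple false w.
Proof. exact: val_inj. Qed.

Lemma act_b_neq n (u : word n.+1) : act gen_b u != u.
Proof. by case/tupleP: u => [[] w]; rewrite ?act_b0 ?act_b1. Qed.

(** * Sets of words split by the first letter *)

Lemma cons_tuple_inj n c : injective (fun w : word n => cons_tuple c w).
Proof. by move=> u v /(congr1 val) [] /val_inj. Qed.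

Definition tail n (u : word n.+1) : word n := behead_tuple u.

Lemma tail_cons n c (w : word n) : tail (cons_tuple c w) = w.
Proof. exact: val_inj. Qed.

Definition glue n (S0 S1 : {set word n}) : {set word n.+1} :=
  [set u | tail u \in if thead u then S1 else S0].

Lemma in_glue n c (w : word n) S0 S1 :
  (cons_tuple c w \in glue S0 S1) = (w \in if c then S1 else S0).
Proof. by rewrite inE theadE tail_cons. Qed.

Lemma glue_inj n (S0 S1 T0 T1 : {set word n}) :
  glue S0 S1 = glue T0 T1 -> S0 = T0 /\ S1 = T1.
Proof.
move=> /setP eqST; split; apply/setP=> w.
  by have := eqST (cons_tuple false w); rewrite !in_glue.
by have := eqST (cons_tuple true w); rewrite !in_glue.
Qed.

Lemma glue_surj n (S : {set word n.+1}) : exists S0 S1, S = glue S0 S1.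
Proof.
exists [set w | cons_tuple false w \in S], [set w | cons_tuple true w \in S].
by apply/setP=> u; case/tupleP: u => [[] w]; rewrite in_glue inE.
Qed.

Lemma setC_glue n (S0 S1 : {set word n}) : ~: glue S0 S1 = glue (~: S0) (~: S1).
Proof.
by apply/setP=> u; case/tupleP: u => [[] w]; rewrite inE !in_glue inE.
Qed.

Lemma preim_a_glue n (S0 S1 : {set word n}) :
  act gen_a @^-1: glue S0 S1 = glue (act gen_b @^-1: S0) S1.
Proof.
by apply/setP=> u; case/tupleP: u => [[] w];
  rewrite inE ?act_a0 ?act_a1 !in_glue ?inE.
Qed.

Lemma preim_b_glue n (S0 S1 : {set word n}) :
  act gen_b @^-1: glue S0 S1 = glue (act gen_a @^-1: S1) S0.
Proof.
by apply/setP=> u; case/tupleP: u => [[] w];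
  rewrite inE ?act_b0 ?act_b1 !in_glue ?inE.
Qed.

(** * Counting invariant and alternating sets *)

Definition invariant_sets n s : {set {set word n}} :=
  [set T : {set word n} | act s @^-1: T == T].

(** Such an [S] holds exactly one of [u] and [act gen_b u], the sources of the two [b]-edges at the
    vertex [act gen_b u]. *)
Definition alternating_sets n : {set {set word n}} :=
  [set S : {set word n} | act gen_b @^-1: S == ~: S].

Lemma card_set_word n : #|{set word n}| = (2 ^ (2 ^ n))%N.
Proof.
by rewrite -cardsT -powersetT card_powerset cardsT card_tuple card_bool.
Qed.

Lemma invariant_sets0 s : #|invariant_sets 0 s| = 2.
Proof.
rewrite (_ : invariant_sets 0 s = setT) ?cardsT ?card_set_word //.
apply/setP=> T; rewrite !inE; apply/eqP/setP=> u; rewrite inE.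
by congr (_ \in T); rewrite [u]tuple0 [LHS]tuple0.
Qed.

(** Behind the letter 0, [a] acts as [b], which constrains [S0]; it fixes every word [1w], so [S1]
    is arbitrary and gives the second factor. *)
Lemma invariant_sets_aS n :
  #|invariant_sets n.+1 gen_a| = (#|invariant_sets n gen_b| * 2 ^ (2 ^ n))%N.
Proof.
pose f (p : {set word n} * {set word n}) := glue p.1 p.2.
have f_inj : injective f by move=> [? ?] [? ?] /glue_inj [/= -> ->].
have -> : invariant_sets n.+1 gen_a = f @: setX (invariant_sets n gen_b) setT.
  apply/setP=> S; apply/idP/imsetP => [|[[S0 S1]]].
    have [S0 [S1 ->]] := glue_surj S.
    rewrite inE preim_a_glue => /eqP/glue_inj [inv0 _].
    by exists (S0, S1); rewrite // !inE inv0 eqxx.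
  by rewrite !inE andbT => /eqP inv0 ->; rewrite preim_a_glue inv0.
by rewrite card_imset // cardsX cardsT card_set_word.
Qed.

(** [b] exchanges the two halves, so they must coincide; going around twice applies [a] once. *)
Lemma invariant_sets_bS n :
  #|invariant_sets n.+1 gen_b| = #|invariant_sets n gen_a|.
Proof.
pose f (T : {set word n}) := glue T T.
have f_inj : injective f by move=> ? ? /glue_inj [].
rewrite -(card_imset _ f_inj); congr #|pred_of_set _|.
apply/setP=> S; apply/idP/imsetP => [|[T]].
  have [S0 [S1 ->]] := glue_surj S.
  rewrite inE preim_b_glue => /eqP/glue_inj [inv1 eq01].
  by exists S1; rewrite ?inE ?inv1 eq01.
by rewrite !inE => /eqP invT ->; rewrite preim_b_glue invT.
Qed.

(** As for [b]-invariant sets, but each passage between halves complements, and two complements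
    cancel. *)
Lemma card_alternating_sets n :
  #|alternating_sets n.+1| = #|invariant_sets n gen_a|.
Proof.
pose f (T : {set word n}) := glue T (~: T).
have f_inj : injective f by move=> ? ? /glue_inj [].
rewrite -(card_imset _ f_inj); congr #|pred_of_set _|.
apply/setP=> S; apply/idP/imsetP => [|[T]].
  have [S0 [S1 ->]] := glue_surj S.
  rewrite inE preim_b_glue setC_glue => /eqP/glue_inj [inv1 eq01].
  exists S0; last by rewrite /f {3}eq01 setCK.
  by rewrite inE {1}eq01 preimsetC inv1 setCK.
rewrite !inE => /eqP invT ->.
by rewrite preim_b_glue setC_glue setCK preimsetC invT.
Qed.

(** The recursions combine to [A(n+2) = A(n) 2^(2^(n+1))]. The added 1 or 2 makes the division by 3
    exact. *)
Lemma card_invariant_sets n :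
  #|invariant_sets n gen_a| =
    (2 ^ ((2 ^ n.+1 + (if odd n then 2 else 1)) %/ 3))%N.
Proof.
have [m] := ubnP n; elim: m n => // m IHm [|[|n]] ltnm.
- by rewrite invariant_sets0.
- by rewrite invariant_sets_aS invariant_sets0.
rewrite invariant_sets_aS invariant_sets_bS IHm; last by lia.
rewrite -expnD /= negbK; congr (2 ^ _)%N.
(* The quotient by 3 thus grows by [2 ^ n.+1], the exponent of the new factor. *)
rewrite [in RHS](_ : 2 ^ n.+3 = 2 ^ n.+1 * 3 + 2 ^ n.+1)%N; last first.
  by rewrite 2!(expnS 2 _.+1); lia.
by rewrite -addnA divnMDl // addnC.
Qed.

Lemma card_alternating n (S : {set word n.+1}) :
  S \in alternating_sets n.+1 -> #|S| = (2 ^ n)%N.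
Proof.
rewrite inE => /eqP altS.
(* The complement of [S] is its preimage under a bijection, so both have the same size. *)
have := cardsC S; rewrite -altS card_preimset; last exact: act_inj.
by rewrite card_tuple card_bool expnS; lia.
Qed.

(** * Coverings made of [b]-edges *)

Definition b_edges n (S : {set word n}) : {set generator * word n} :=
  [set (gen_b, u) | u in S].

Lemma b_edges_inj n : injective (@b_edges n).
Proof. by apply: imset_inj => u v []. Qed.

(** Taking the vertex in the form [act gen_b u] names its two [b]-edges, with sources [u] and
    [act gen_b u], without an inverse of [b]. *)
Lemma card_incident_b_edges n (S : {set word n.+1}) u :
  #|[set e in b_edges S | incident (act gen_b u) e]| =
    ((u \in S) + (act gen_b u \in S))%N.
Proof.
have pair_inj : injective (fun v : word n.+1 => (gen_b, v)) by move=> ? ? [].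
have -> : [set e in b_edges S | incident (act gen_b u) e] =
    b_edges ([set u; act gen_b u] :&: S).
  apply/setP=> -[s v]; rewrite inE /incident /=.
  apply/andP/imsetP => [[/imsetP[w Sw [-> ->]]]|[w + [-> ->]]].
    rewrite (inj_eq (@act_inj _ _)) => inc.
    by exists w; rewrite // !inE Sw andbT orbC eq_sym [w == u]eq_sym.
  rewrite !inE => /andP[inc Sw]; split; first exact: imset_f.
  by rewrite (inj_eq (@act_inj _ _)) orbC eq_sym [_ == w]eq_sym.
rewrite card_imset // setIUl cardsU -setIIl.
(* [b] has no fixed point, so the two edges are distinct, even when parallel. *)
rewrite (_ : [set u] :&: [set act gen_b u] = set0); last first.
  by apply/setP=> x; rewrite !inE; case: eqP => // ->;
    rewrite eq_sym (negPf (act_b_neq u)).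
have card1I (x : word n.+1) : #|[set x] :&: S| = (x \in S).
  case: (boolP (x \in S)) => Sx; first by rewrite (setIidPl _) ?sub1set ?cards1.
  by apply/eqP; rewrite cards_eq0 setI_eq0 disjoints1.
by rewrite set0I cards0 subn0 !card1I.
Qed.

Lemma dimer_covering_b_edges n (S : {set word n.+1}) :
  dimer_covering (b_edges S) = (S \in alternating_sets n.+1).
Proof.
have sub : b_edges S \subset schreier_edges n.+1.
  by apply/subsetP=> _ /imsetP[u _ ->]; rewrite inE act_b_neq.
rewrite /dimer_covering sub inE /=; apply/forallP/eqP => [cov|altS v].
  apply/setP=> u; have := cov (act gen_b u).
  by rewrite card_incident_b_edges !inE; do 2!case: (_ \in S).
have -> : v = act gen_b (invF (@act_inj _ gen_b) v) by rewrite f_invF.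
move/setP/(_ (invF (@act_inj _ gen_b) v)): altS.
by rewrite card_incident_b_edges !inE => ->; case: (_ \in S).
Qed.

(** * Exclusion of [a]-edges *)

Lemma dimer_covering_unique n (M : {set generator * word n}) v e f :
  dimer_covering M -> e \in M -> f \in M ->
  incident v e -> incident v f -> e = f.
Proof.
case/andP=> _ /forallP/(_ v)/cards1P[g Mg] Me Mf ve vf.
have /set1P-> : e \in [set g] by rewrite -Mg inE Me.
by have /set1P-> : f \in [set g] by rewrite -Mg inE Mf.
Qed.

Lemma dimer_covering_label n (M : {set generator * word n.+1}) e :
  dimer_covering M -> e \in M -> e.1 = gen_b.
Proof.
move=> covM; have /andP[/subsetP subM /forallP cov1] := covM.
have a_source u : (gen_a, u) \in M -> thead u = false.
  move/subM; rewrite inE /=; case/tupleP: u => [[] w]; last by rewrite theadE.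
  by rewrite act_a1 eqxx.
pose S := [set u | (gen_b, u) \in M].
have inc0 (u : word n.+1) : incident (cons_tuple false (tail u)) (gen_b, u).
  by case/tupleP: u => [[] w]; rewrite /incident /= tail_cons ?act_b1 eqxx ?orbT.
(* The edge [(gen_b, u)] joins the words [0 (tail u)] and [1 (top u)]. *)
pose top (u : word n.+1) := if thead u then tail u else act gen_a (tail u).
have top_surj : top @: S = setT.
  apply/setP=> w; rewrite inE; apply/imsetP.
  have /cards1P[[s u] Mu] := cov1 (cons_tuple true w).
  have : (s, u) \in [set (s, u)] by apply: set11.
  rewrite -Mu inE => /andP[{}Mu]; rewrite /incident /=.
  (* An [a]-edge joins two words starting with 0, so it cannot cover [1w]. *)
  case: s => [|] in Mu *.
    move: (a_source _ Mu); case/tupleP: u {Mu} => [c x]; rewrite theadE => ->.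
    by rewrite act_a0 => /orP[] /eqP/(congr1 val).
  move=> inc; exists u; first by rewrite inE.
  case/tupleP: u inc {Mu} => [[] x]; rewrite /top theadE tail_cons.
    by rewrite act_b1 => /orP[/eqP/cons_tuple_inj | /eqP/(congr1 val)].
  by rewrite act_b0 => /orP[/eqP/(congr1 val) | /eqP/cons_tuple_inj].
have tail_inj : {in S &, injective (@tail n)}.
  move=> u v; rewrite !inE => Mu Mv eq_uv.
  have := inc0 v; rewrite -eq_uv => incv.
  by have [] := dimer_covering_unique covM Mu Mv (inc0 u) incv.
(* Surjectivity of [top] gives [S] at least as many elements as there are words of length [n]; an
   injective [tail] then reaches all of them. *)
have tail_surj : @tail n @: S = setT.
  apply/eqP; rewrite eqEcard subsetT card_in_imset // -top_surj.
  exact: leq_imset_card.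
case: e => -[|] // u Mu.
have : tail u \in @tail n @: S by rewrite tail_surj inE.
case/imsetP=> v; rewrite inE => Mv eq_uv.
(* The source of an [a]-edge would be covered a second time, by the [b]-edge from [v]. *)
have incu : incident (cons_tuple false (tail u)) (gen_a, u).
  move: (a_source _ Mu); case/tupleP: {Mu eq_uv} u => c x; rewrite theadE => ->.
  by rewrite /incident tail_cons eqxx.
have := inc0 v; rewrite -eq_uv => incv.
by have := dimer_covering_unique covM Mu Mv incu incv.
Qed.

Lemma dimer_coveringE n (M : {set generator * word n.+1}) :
  dimer_covering M = (M \in @b_edges n.+1 @: alternating_sets n.+1).
Proof.
apply/idP/imsetP => [covM|[S altS ->]]; last by rewrite dimer_covering_b_edges.
have defM : M = b_edges [set u | (gen_b, u) \in M].
  apply/setP=> -[s u]; apply/idP/imsetP => [|[v + [-> ->]]]; last by rewrite inE.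
  by move=> Mu; have /= eq_s := dimer_covering_label covM Mu; exists u;
    rewrite ?inE -eq_s.
by exists [set u | (gen_b, u) \in M]; rewrite // -dimer_covering_b_edges -defM.
Qed.

(** All coverings have the same weight, being made of [2 ^ n] edges labeled [b]. *)
Lemma dimer_partitionS (R : comPzSemiRingType) n (a b : R) :
  dimer_partition n.+1 a b = b ^+ (2 ^ n) *+ #|invariant_sets n gen_a|.
Proof.
rewrite /dimer_partition (eq_bigl _ _ (@dimer_coveringE n)).
rewrite big_imset /=; last by move=> S T _ _; apply: b_edges_inj.
rewrite -card_alternating_sets -sumr_const; apply: eq_bigr => S altS.
rewrite big_imset /=; last by move=> u v _ _ [].
by rewrite prodr_const card_alternating.
Qed.

Theorem theorem2p7 (R : realFieldType) (n : nat) (a b : R)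
    (hn : (1 <= n)%N) (ha : 0 < a) (hb : 0 < b) :
  dimer_partition n a b =
    if odd n then 2 ^+ ((2 ^ n + 1) %/ 3) * b ^+ (2 ^ (n - 1))
    else 2 ^+ ((2 ^ n + 2) %/ 3) * b ^+ (2 ^ (n - 1)).
Proof.
case: n hn => // n _; rewrite dimer_partitionS card_invariant_sets subn1 /=.
by case: (odd n); rewrite -mulr_natl natrX.
Qed.
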